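(* Let $\gamma_j$ denote the $j$-th Stieltjes constant. For every non-negative integer $k$ and every $x>1$, $$\begin{aligned}&\sum_{j=0}^{k}\binom kj\frac{(-1)^{j+1}}{j+1}\left(\frac{\log(x)}{2}\right)^{k-j}\left(\Phi_{j+1}'(x)-\Phi_{j+1}'(x-1)+\frac{1}{x^2}(-1)^{k-j}\Phi_{j+1}'\!\left(\frac{x-1}{x}\right)\right)\\&=\sum_{j=0}^{k}\binom kj\left(\frac{\log(x)}{2}\right)^{k-j}\sum_{\ell=0}^{j}\binom j\ell(-1)^j\gamma_{j-\ell}\left\{\frac{\log^\ell(x)}{x}-\frac{\log^\ell(x-1)}{x-1}+\frac{(-1)^{k-j}\log^\ell\left(\frac{x-1}{x}\right)}{x(x-1)}\right\}\\&\quad+\frac{1}{(k+1)x}\left\{\left(\frac{-\log(x)}{2}\right)^{k+1}-\left(\frac{\log(x)}{2}-\log(x-1)\right)^{k+1}\right\}.\end{aligned}$$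
   Context: $\log^\ell(y)=(\log y)^\ell$, with $\log^0(y)=1$. The Stieltjes constants are defined by $\zeta(s)=\frac1{s-1}+\sum_{k\ge0}\frac{(-1)^k\gamma_k}{k!}(s-1)^k$ ($\gamma_0=\gamma$ is Euler's constant). Ishibashi functions: for $k\in\mathbb{N}$ and $x\in\mathbb{C}\setminus(-\infty,0]$, $$\Phi_k(x):=\sum_{n=1}^{\infty}\frac{k\,\psi_{k-1}(nx)-\log^k(nx)}{n},\qquad \psi_k(x):=-\gamma_k-\frac{\log^k(x)}{x}-\sum_{n=1}^{\infty}\left(\frac{\log^k(n+x)}{n+x}-\frac{\log^k(n)}{n}\right)\ (k\ge0).$$ $\Phi_j'$ is the derivative of $\Phi_j$, so $\Phi_j'(x)=j\sum_{n=1}^{\infty}\left(\psi_{j-1}'(nx)-\frac{\log^{j-1}(nx)}{nx}\right)$. *)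

(* Defs.v *)
From Stdlib Require Import Reals Factorial ClassicalEpsilon.
From Coquelicot Require Import Coquelicot.
Open Scope R_scope.

(* Dirichlet series of the Riemann zeta function; meaningful for [1 < s]. *)
Definition zeta (s : R) : R := Series (fun n => / Rpower (INR (S n)) s).

(* [c k] are the coefficients of the Laurent expansion at [s = 1]
   zeta(s) = 1/(s-1) + sum_k (-1)^k c_k / k! (s-1)^k.  A right neighbourhood of
   [1] in [R] suffices to determine the sequence [c] uniquely. *)
Definition zeta_laurent (c : nat -> R) : Prop :=
  exists delta : R, 0 < delta /\
    forall s : R, 1 < s < 1 + delta ->
      is_pseries (fun k => (-1) ^ k * c k / INR (fact k)) (s - 1)
                 (zeta s - 1 / (s - 1)).

Definition stieltjes : nat -> R :=
  epsilon (inhabits (fun _ : nat => 0)) zeta_laurent.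

(* [psi] and [Phi] are the restrictions to the positive real axis of functions
   holomorphic on C \ (-oo, 0]; the series are indexed from [0], so that the
   summation index of the usual formulas is [S n]. *)
Definition psi (k : nat) (x : R) : R :=
  - stieltjes k - ln x ^ k / x
  - Series (fun n => ln (INR (S n) + x) ^ k / (INR (S n) + x)
                     - ln (INR (S n)) ^ k / INR (S n)).

(* Ishibashi function of index [k >= 1]; [Phi 0] is irrelevant. *)
Definition Phi (k : nat) (x : R) : R :=
  Series (fun n => (INR k * psi (k - 1) (INR (S n) * x)
                    - ln (INR (S n) * x) ^ k) / INR (S n)).

Definition dPhi (k : nat) (x : R) : R := Derive (Phi k) x.

(* Main.v *)
(* With the generating function sum_k Phi'_(k+1)(x) / (k+1) * t^k / k! the claim
   becomes a single identity in t.  At t = -u with u > 0 this function equals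
   (1 + u) A(x) - x^(-1-u) zeta(1+u), where
     A(x) = sum over n >= 1, m >= 0 of (n x + m)^(-2-u)
   converges absolutely.  Since n (x-1) + m = n x + (m - n), splitting the inner sum
   at m = n and rescaling the part m < n gives
     A(x-1) - A(x) = x^(-2-u) A((x-1)/x).
   Multiplying the resulting relation by x^(u/2), inserting the Laurent expansion of
   zeta(1+u) and comparing the coefficients of u^k yields the statement. *)
Require Import Defs.
From Stdlib Require Import Reals Lra Lia Arith Factorial ClassicalEpsilon.
From Coquelicot Require Import Coquelicot.
Open Scope R_scope.

(** * Series *)

(** A(x) and zeta(1+u) both have a pole at u = 0, so neither alone has coefficients to compare; only
    their combination is regular. The coefficients are therefore controlled before the two are
    separated: psi_k(y) - log^(k+1)(y)/(k+1) is a sum of Euler-Maclaurin remainders, estimated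
    uniformly in k up to a factor k! 2^k. Such a remainder decays like y^(-3/2), its derivative like
    y^(-5/2); summing over m loses one power of y, which leaves n^(-3/2) for the sum over n. Against
    t^k / k! the factor k! 2^k gives a geometric series for |t| < 1/2, so the sum over k may be
    exchanged with those over m and n. Only at t = -u < 0, where all parts converge separately, is
    the result split into a lattice sum and a zeta value. The powers arise because log^k(y)/y has
    exponential generating function y^(t-1). The same remainders at y = 1, 2, ... produce the
    Laurent coefficients of zeta, and so a witness for the choice behind [stieltjes]. *)

Lemma is_series_ext_R (a b : nat -> R) (l : R) :
  (forall n, a n = b n) -> is_series a l -> is_series b l.
Proof. exact (@is_series_ext R_AbsRing R_NormedModule a b l). Qed.

Lemma ex_series_ext_R (a b : nat -> R) :
  (forall n, a n = b n) -> ex_series a -> ex_series b.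
Proof. exact (@ex_series_ext R_AbsRing R_NormedModule a b). Qed.

Lemma is_series_telescope (T : nat -> R) (l : R) :
  is_lim_seq T l -> is_series (fun n => T (S n) - T n) (l - T 0%nat).
Proof.
  intros H.
  change (is_lim_seq (sum_n (fun n => T (S n) - T n)) (l - T 0%nat)).
  apply is_lim_seq_ext with (fun n => T (S n) - T 0%nat).
  - induction n as [|n IH].
    + now rewrite sum_O.
    + rewrite sum_Sn, <- IH. unfold plus; simpl; ring.
  - apply is_lim_seq_minus'; [now apply (is_lim_seq_incr_1 T)|].
    apply is_lim_seq_const.
Qed.

(** The partial sums of |a n| are at most g 0 - g (S n) <= g 0, and [g] need not tend to 0. This
    takes the place of integral comparison: convergence and a bound come from one telescoping
    majorant. *)
Lemma ex_series_Rabs_telescope (a g : nat -> R) :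
  (forall n, Rabs (a n) <= g n - g (S n)) -> (forall n, 0 <= g n) ->
  ex_series (fun n => Rabs (a n)) /\ Rabs (Series a) <= g 0%nat.
Proof.
  intros Ha Hg.
  assert (Hs : forall n, sum_n (fun k => Rabs (a k)) n <= g 0%nat - g (S n)).
  { induction n as [|n IH].
    - rewrite sum_O. apply Ha.
    - rewrite sum_Sn. generalize (Ha (S n)). unfold plus; simpl. lra. }
  assert (E : ex_series (fun n => Rabs (a n))).
  { destruct (ex_finite_lim_seq_incr (sum_n (fun k => Rabs (a k))) (g 0%nat))
      as [l Hl].
    - intros n. rewrite sum_Sn. unfold plus; simpl.
      generalize (Rabs_pos (a (S n))). lra.
    - intros n. generalize (Hs n) (Hg (S n)). lra.
    - exists l. exact Hl. }
  split; [exact E|].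
  apply Rle_trans with (1 := Series_Rabs a E).
  apply (is_lim_seq_le (sum_n (fun k => Rabs (a k))) (fun _ => g 0%nat)
           (Series (fun k => Rabs (a k))) (g 0%nat)).
  - intros n. generalize (Hs n) (Hg (S n)). lra.
  - exact (Series_correct _ E).
  - apply is_lim_seq_const.
Qed.

Lemma ex_series_dominated (a b : nat -> R) :
  (forall n, Rabs (a n) <= b n) -> ex_series b -> ex_series a.
Proof. exact (@ex_series_le R_AbsRing R_CompleteNormedModule a b). Qed.

Lemma Series_dominated (a b : nat -> R) :
  (forall n, Rabs (a n) <= b n) -> ex_series b -> Rabs (Series a) <= Series b.
Proof.
  intros H E.
  apply Rle_trans with (Series (fun n => Rabs (a n))).
  - apply Series_Rabs. apply ex_series_dominated with b; [|exact E].
    intros n. now rewrite Rabs_Rabsolu.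
  - apply Series_le; [|exact E].
    intros n. split; [apply Rabs_pos | apply H].
Qed.

Lemma ex_series_scal_R (c : R) (a : nat -> R) :
  ex_series a -> ex_series (fun n => c * a n).
Proof. exact (@ex_series_scal R_AbsRing R_NormedModule c a). Qed.

Lemma is_series_scal_R (c : R) (a : nat -> R) (l : R) :
  is_series a l -> is_series (fun n => c * a n) (c * l).
Proof. exact (@is_series_scal R_AbsRing R_NormedModule c a l). Qed.

Lemma Series_sum_n (a : nat -> nat -> R) :
  (forall n, ex_series (a n)) -> forall N,
  is_series (fun m => sum_n (fun n => a n m) N) (sum_n (fun n => Series (a n)) N).
Proof.
  intros E. induction N as [|N IH].
  - rewrite sum_O. apply is_series_ext_R with (a 0%nat).
    + intros m. now rewrite sum_O.
    + apply Series_correct, E.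
  - rewrite sum_Sn.
    apply is_series_ext_R with (fun m => plus (sum_n (fun n => a n m) N) (a (S N) m)).
    + intros m. now rewrite sum_Sn.
    + apply (is_series_plus _ _ _ _ IH). apply Series_correct, E.
Qed.

Lemma Series_tail_dominated (a b : nat -> R) (N : nat) :
  (forall n, Rabs (a n) <= b n) -> ex_series b ->
  Rabs (Series a - sum_n a N) <= Series b - sum_n b N.
Proof.
  intros H E.
  assert (Ea := ex_series_dominated a b H E).
  rewrite (Series_incr_n a (S N)), (Series_incr_n b (S N)) by (auto; lia).
  rewrite !sum_n_Reals. simpl Init.Nat.pred.
  replace (_ + _ - sum_f_R0 a N) with (Series (fun k => a (S N + k)%nat)) by ring.
  replace (_ + _ - sum_f_R0 b N) with (Series (fun k => b (S N + k)%nat)) by ring.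
  apply Series_dominated; [intros; apply H|].
  now apply (ex_series_incr_n b (S N)).
Qed.

(** With a majorant in product form, the remainder after N rows is at most (tail of [u] after N) *
    Series v, which tends to 0. *)
Lemma is_series_swap (a : nat -> nat -> R) (u v : nat -> R) :
  (forall n m, Rabs (a n m) <= u n * v m) -> ex_series u -> ex_series v ->
  is_series (fun n => Series (fun m => a n m)) (Series (fun m => Series (fun n => a n m))).
Proof.
  intros H Eu Ev.
  assert (E1 : forall n, ex_series (a n)).
  { intros n. apply ex_series_dominated with (fun m => u n * v m); [auto|].
    now apply ex_series_scal_R. }
  assert (E2 : forall m, ex_series (fun n => a n m)).
  { intros m. apply ex_series_dominated with (fun n => v m * u n).
    - intros n. rewrite Rmult_comm. apply H.
    - now apply ex_series_scal_R. }
  assert (E3 : ex_series (fun m => Series (fun n => a n m))).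
  { apply ex_series_dominated with (fun m => Series u * v m).
    - intros m. rewrite Rmult_comm, <- Series_scal_l.
      apply Series_dominated.
      + intros n. rewrite Rmult_comm. apply H.
      + now apply ex_series_scal_R.
    - now apply ex_series_scal_R. }
  change (is_lim_seq (sum_n (fun n => Series (fun m => a n m)))
            (Series (fun m => Series (fun n => a n m)))).
  set (S0 := Series (fun m => Series (fun n => a n m))).
  assert (Hu : is_lim_seq (fun N => (Series u - sum_n u N) * Series v) 0).
  { replace (Finite 0) with (Finite ((Series u - Series u) * Series v)) by (f_equal; ring).
    apply is_lim_seq_mult'; [|apply is_lim_seq_const].
    apply is_lim_seq_minus'; [apply is_lim_seq_const|].
    exact (Series_correct _ Eu). }
  apply is_lim_seq_ext with (fun N => S0 - (S0 - sum_n (fun n => Series (fun m => a n m)) N)).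
  { intros N. ring. }
  replace (Finite S0) with (Finite (S0 - 0)) by (f_equal; ring).
  apply is_lim_seq_minus'; [apply is_lim_seq_const|].
  apply is_lim_seq_abs_0.
  apply (is_lim_seq_le_le (fun _ => 0) _ (fun N => (Series u - sum_n u N) * Series v)).
  - intros N. split; [apply Rabs_pos|].
    assert (Hs := Series_sum_n a E1 N).
    assert (Hq : sum_n (fun n => Series (fun m => a n m)) N
                 = Series (fun m => sum_n (fun n => a n m) N))
      by (symmetry; exact (is_series_unique _ _ Hs)).
    rewrite Hq. unfold S0. rewrite <- Series_minus; [|exact E3|eexists; exact Hs].
    rewrite <- Series_scal_l.
    apply Series_dominated; [|now apply ex_series_scal_R].
    intros m.
    replace ((Series u - sum_n u N) * v m)
      with (Series (fun n => u n * v m) - sum_n (fun n => u n * v m) N).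
    + apply Series_tail_dominated; [auto|].
      apply ex_series_ext_R with (fun n => v m * u n); [intros n; apply Rmult_comm|].
      now apply ex_series_scal_R.
    + rewrite Series_scal_r, Rmult_minus_distr_r. f_equal.
      exact (sum_n_mult_r (v m) u N).
  - apply is_lim_seq_const.
  - exact Hu.
Qed.

(** Weierstrass M-test for the derived series: the tail of [v] bounds the error uniformly on the
    ball. *)
Lemma is_derive_Series (u u' : nat -> R -> R) (v : nat -> R) (c : R) (r : posreal) :
  (forall n y, Rabs (y - c) < r -> is_derive (u n) y (u' n y)) ->
  (forall n y, Rabs (y - c) < r -> Rabs (u' n y) <= v n) ->
  (forall y, Rabs (y - c) < r -> ex_series (fun n => u n y)) ->
  ex_series v ->
  is_derive (fun y => Series (fun n => u n y)) c (Series (fun n => u' n c)).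
Proof.
  intros Hd Hb Hu Ev. apply is_derive_Reals.
  apply (CVU_derivable (fun N y => sum_n (fun n => u n y) N)
           (fun N y => sum_n (fun n => u' n y) N)
           (fun y => Series (fun n => u n y))
           (fun y => Series (fun n => u' n y)) c r).
  - intros eps He.
    assert (L := Series_correct v Ev).
    change (is_lim_seq (sum_n v) (Series v)) in L.
    apply is_lim_seq_spec in L.
    destruct (L (mkposreal eps He)) as [N HN]. exists N.
    intros n y Hn Hy. apply Rle_lt_trans with (Series v - sum_n v n).
    + apply Series_tail_dominated; [|exact Ev]. intros k. now apply Hb.
    + specialize (HN n Hn). simpl in HN. apply Rabs_def2 in HN. lra.
  - intros y Hy. apply is_lim_seq_Reals. apply (Series_correct _ (Hu y Hy)).
  - intros N y Hy. apply is_derive_Reals.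
    apply (is_derive_sum_n (fun n => u n) N y (fun n => u' n y)).
    intros k _. now apply Hd.
  - unfold Boule. rewrite Rminus_eq_0, Rabs_R0. apply cond_pos.
Qed.

(** * Exponential generating functions *)

(* Only a right neighbourhood of 0 is required: the lattice sums below converge
   for u > 0 only, and one side still determines the coefficients. *)
Definition has_egf (a : nat -> R) (f : R -> R) : Prop :=
  exists delta : R, 0 < delta /\ forall u, 0 < u < delta ->
    is_series (fun k => a k / INR (fact k) * u ^ k) (f u)
    /\ ex_series (fun k => Rabs (a k / INR (fact k) * u ^ k)).

(** Absolute convergence is automatic: convergence at the larger point (u + delta) / 2 forces the
    radius of convergence to exceed u. *)
Lemma has_egf_of_is_series (a : nat -> R) (f : R -> R) (delta : R) :
  0 < delta ->
  (forall u, 0 < u < delta -> is_series (fun k => a k / INR (fact k) * u ^ k) (f u)) ->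
  has_egf a f.
Proof.
  intros Hd H. exists delta. split; [exact Hd|]. intros u Hu.
  split; [now apply H|].
  apply (CV_disk_inside (fun k => a k / INR (fact k))).
  destruct (Rbar_lt_le_dec (CV_radius (fun k => a k / INR (fact k)))
              (Rabs ((u + delta) / 2))) as [Hlt|Hle].
  - exfalso. apply (CV_disk_outside _ _ Hlt), ex_series_lim_0.
    eexists. apply H. lra.
  - apply Rbar_lt_le_trans with (2 := Hle). simpl.
    rewrite !Rabs_right; lra.
Qed.

Lemma has_egf_ext (delta : R) (a b : nat -> R) (f g : R -> R) :
  0 < delta -> (forall k, a k = b k) -> (forall u, 0 < u < delta -> f u = g u) ->
  has_egf a f -> has_egf b g.
Proof.
  intros He Hab Hfg [d [Hd H]].
  apply has_egf_of_is_series with (Rmin d delta); [now apply Rmin_pos|].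
  intros u Hu. assert (Hl := Rmin_l d delta). assert (Hr := Rmin_r d delta).
  rewrite <- Hfg by lra.
  apply is_series_ext_R with (fun k => a k / INR (fact k) * u ^ k).
  - intros k. now rewrite Hab.
  - apply H. lra.
Qed.

Lemma has_egf_plus (a b : nat -> R) (f g : R -> R) :
  has_egf a f -> has_egf b g ->
  has_egf (fun k => a k + b k) (fun u => f u + g u).
Proof.
  intros [d [Hd H]] [e [He G]].
  apply has_egf_of_is_series with (Rmin d e); [now apply Rmin_pos|].
  intros u Hu.
  assert (Hl := Rmin_l d e). assert (Hr := Rmin_r d e).
  apply is_series_ext_R with
    (fun k => plus (a k / INR (fact k) * u ^ k) (b k / INR (fact k) * u ^ k)).
  - intros k. unfold plus; simpl. unfold Rdiv. ring.
  - apply (is_series_plus (V := R_NormedModule)); [apply H; lra | apply G; lra].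
Qed.

Lemma has_egf_scal (c : R) (a : nat -> R) (f : R -> R) :
  has_egf a f -> has_egf (fun k => c * a k) (fun u => c * f u).
Proof.
  intros [d [Hd H]]. apply has_egf_of_is_series with d; [exact Hd|].
  intros u Hu. apply is_series_ext_R with (fun k => c * (a k / INR (fact k) * u ^ k)).
  - intros k. unfold Rdiv. ring.
  - now apply is_series_scal_R, H.
Qed.

(** Cauchy product, for which [has_egf] records absolute convergence; the factorials turn the
    convolution into a binomial one. *)
Lemma has_egf_mult (a b : nat -> R) (f g : R -> R) :
  has_egf a f -> has_egf b g ->
  has_egf (fun k => sum_f_R0 (fun j => Binomial.C k j * a j * b (k - j)%nat) k)
    (fun u => f u * g u).
Proof.
  intros [d [Hd H]] [e [He G]].
  apply has_egf_of_is_series with (Rmin d e); [now apply Rmin_pos|].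
  intros u Hu.
  assert (Hl := Rmin_l d e). assert (Hr := Rmin_r d e).
  destruct (H u) as [H1 H2]; [lra|]. destruct (G u) as [G1 G2]; [lra|].
  apply is_series_ext_R with (2 := is_series_mult _ _ _ _ H1 G1 H2 G2).
  intros k. unfold Rdiv. rewrite Rmult_assoc, Rmult_comm, scal_sum.
  apply sum_eq. intros j Hj. unfold Binomial.C, Rdiv.
  replace (u ^ k) with (u ^ j * u ^ (k - j)) by (rewrite <- pow_add; f_equal; lia).
  generalize (INR_fact_neq_0 j) (INR_fact_neq_0 k) (INR_fact_neq_0 (k - j)). intros.
  field. auto.
Qed.

Lemma is_series_exp (x : R) : is_series (fun n => / INR (fact n) * x ^ n) (exp x).
Proof. exact (proj1 (is_pseries_R _ x (exp x)) (is_exp_Reals x)). Qed.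

Lemma has_egf_exp (c : R) : has_egf (fun k => c ^ k) (fun u => exp (c * u)).
Proof.
  apply has_egf_of_is_series with 1; [lra|]. intros u _.
  apply is_series_ext_R with (fun k => / INR (fact k) * (c * u) ^ k).
  - intros k. rewrite Rpow_mult_distr. unfold Rdiv. ring.
  - apply is_series_exp.
Qed.

(** Once the lower coefficients vanish, division by u^k leaves b k = - u * Series (q u). The series
    is bounded by its absolute version at the fixed point w, so letting u decrease to 0 gives b k =
    0. *)
Lemma has_egf_zero (a : nat -> R) : has_egf a (fun _ => 0) -> forall k, a k = 0.
Proof.
  intros [d [Hd H]]. induction k as [k IH] using (well_founded_induction lt_wf).
  set (b := fun k => a k / INR (fact k)).
  set (w := d / 2).
  set (q := fun u i => b (S k + i)%nat * u ^ i).
  assert (Hw : 0 < w) by (unfold w; lra).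
  assert (Eq : ex_series (fun i => Rabs (q w i))).
  { destruct (H w) as [_ E]; [unfold w; lra|].
    apply (ex_series_incr_n _ (S k)) in E.
    apply ex_series_ext_R with (fun i => / w ^ S k * Rabs (b (S k + i)%nat * w ^ (S k + i))).
    - intros i. unfold q. rewrite pow_add, !Rabs_mult, (Rabs_right (w ^ S k)).
      + field. apply pow_nonzero. lra.
      + apply Rle_ge, pow_le. lra.
    - now apply ex_series_scal_R. }
  assert (Hb : forall u, 0 < u < w -> Rabs (b k) <= u * Series (fun i => Rabs (q w i))).
  { intros u Hu. destruct (H u) as [E _]; [unfold w in Hu; lra|].
    change (is_series (fun k => b k * u ^ k) 0) in E.
    assert (Hqu : forall i, Rabs (q u i) <= Rabs (q w i)).
    { intros i. unfold q. rewrite !Rabs_mult.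
      apply Rmult_le_compat_l; [apply Rabs_pos|].
      rewrite !Rabs_right by (apply Rle_ge, pow_le; lra).
      apply pow_incr. lra. }
    assert (Es := is_series_unique _ _ E).
    rewrite (Series_incr_n _ (S k)) in Es; [|lia|eexists; exact E].
    simpl Init.Nat.pred in Es.
    replace (sum_f_R0 (fun j => b j * u ^ j) k) with (b k * u ^ k) in Es.
    2:{ destruct k as [|k]; [reflexivity|]. rewrite tech5, sum_eq_R0; [ring|].
        intros j Hj. unfold b. rewrite IH by lia. unfold Rdiv. ring. }
    rewrite (Series_ext _ (fun i => u ^ S k * q u i)) in Es.
    2:{ intros i. unfold q. rewrite pow_add. ring. }
    rewrite Series_scal_l in Es. simpl in Es.
    assert (Hp : u ^ k <> 0) by (apply pow_nonzero; lra).
    replace (b k) with (- (u * Series (q u))).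
    - rewrite Rabs_Ropp, Rabs_mult, (Rabs_right u) by lra.
      apply Rmult_le_compat_l; [lra|]. now apply Series_dominated.
    - apply Rmult_eq_reg_r with (u ^ k); [lra|exact Hp]. }
  assert (Hb0 : b k = 0).
  { destruct (Req_dec (b k) 0) as [|Hn]; [easy|exfalso].
    set (M := Series (fun i => Rabs (q w i))) in *.
    assert (HM : 0 <= M).
    { generalize (Hb (w / 2) ltac:(lra)) (Rabs_pos (b k)). intros.
      apply Rmult_le_reg_l with (w / 2); lra. }
    assert (Hbp := Rabs_pos_lt _ Hn).
    (* The first bound keeps e below w; the second gives e * (M + 1) <= |b k| / 2, against |b k| <=
       e * M. *)
    set (e := Rmin (w / 2) (Rabs (b k) / (2 * (M + 1)))).
    assert (He : 0 < e).
    { apply Rmin_pos; [lra|]. apply Rdiv_lt_0_compat; lra. }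
    assert (He1 : e <= w / 2) by apply Rmin_l.
    assert (He2 : e <= Rabs (b k) / (2 * (M + 1))) by apply Rmin_r.
    generalize (Hb e ltac:(lra)). intros Hc.
    assert (e * (M + 1) <= Rabs (b k) / 2).
    { replace (Rabs (b k) / 2) with (Rabs (b k) / (2 * (M + 1)) * (M + 1))
        by (field; lra).
      apply Rmult_le_compat_r; lra. }
    nra. }
  unfold b in Hb0. generalize (INR_fact_neq_0 k). intros Hf.
  replace (a k) with (a k / INR (fact k) * INR (fact k)) by (field; exact Hf).
  rewrite Hb0. ring.
Qed.

Lemma has_egf_unique (delta : R) (a b : nat -> R) (f g : R -> R) :
  0 < delta -> (forall u, 0 < u < delta -> f u = g u) ->
  has_egf a f -> has_egf b g -> forall k, a k = b k.
Proof.
  intros Hd Hfg Ha Hb k. apply Rminus_diag_uniq.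
  apply (has_egf_zero (fun k => a k - b k)).
  apply (has_egf_ext delta) with (4 := has_egf_plus _ _ _ _ Ha (has_egf_scal (-1) _ _ Hb)).
  - exact Hd.
  - intros. ring.
  - intros u Hu. rewrite Hfg by exact Hu. ring.
Qed.

(** Since (k+1) k! = (k+1)!, this is the exponential series without its constant term, divided by t.
    For c = ln y the coefficients are [logF k y]. *)
Lemma is_series_expm1_div (c t : R) : t <> 0 ->
  is_series (fun k => c ^ (k + 1) / INR (k + 1) / INR (fact k) * t ^ k)
    ((exp (c * t) - 1) / t).
Proof.
  intros Ht.
  assert (E := is_series_exp (c * t)).
  apply is_series_ext_R with (fun k => / t * (/ INR (fact (S k)) * (c * t) ^ S k)).
  - intros k. rewrite fact_simpl, mult_INR, Nat.add_1_r, Rpow_mult_distr.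
    simpl pow. generalize (INR_fact_neq_0 k) (not_0_INR (S k) ltac:(lia)). intros.
    field. auto.
  - replace ((exp (c * t) - 1) / t) with (/ t * (exp (c * t) - 1)) by (unfold Rdiv; ring).
    apply is_series_scal_R.
    apply (is_series_incr_1 (fun k => / INR (fact k) * (c * t) ^ k)).
    match goal with |- is_series _ ?l => replace l with (exp (c * t)); [exact E|] end.
    unfold plus; simpl. field.
Qed.

Lemma has_egf_expm1_div (c : R) :
  has_egf (fun k => c ^ (k + 1) / INR (k + 1)) (fun u => (exp (c * u) - 1) / u).
Proof.
  apply has_egf_of_is_series with 1; [lra|]. intros u Hu.
  apply is_series_expm1_div. lra.
Qed.

(** * Euler-Maclaurin remainders *)

Definition logf (k : nat) (y : R) : R := ln y ^ k / y.
Definition logF (k : nat) (y : R) : R := ln y ^ (k + 1) / INR (k + 1).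
(** The subtractions k - 1 and, in [logf''], k - 2 truncate only where the factor k or k (k - 1) in
    front vanishes. *)
Definition logf' (k : nat) (y : R) : R :=
  (INR k * ln y ^ (k - 1) - ln y ^ k) / y ^ 2.
Definition logf'' (k : nat) (y : R) : R :=
  (INR k * (INR k - 1) * ln y ^ (k - 2) - 3 * (INR k * ln y ^ (k - 1))
   + 2 * ln y ^ k) / y ^ 3.

Lemma is_derive_pow_ln (k : nat) (y : R) : 0 < y ->
  is_derive (fun z => ln z ^ k) y (INR k * ln y ^ (k - 1) / y).
Proof.
  intros Hy.
  replace (INR k * ln y ^ (k - 1) / y) with (INR k * (/ y) * ln y ^ pred k).
  - apply (is_derive_pow ln k y (/ y)). now apply is_derive_ln.
  - rewrite Nat.sub_1_r. unfold Rdiv. ring.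
Qed.

Lemma is_derive_logF (k : nat) (y : R) : 0 < y -> is_derive (logF k) y (logf k y).
Proof.
  intros Hy.
  replace (logf k y) with (/ INR (k + 1) * (INR (k + 1) * ln y ^ (k + 1 - 1) / y)).
  - apply is_derive_ext with (fun z => / INR (k + 1) * ln z ^ (k + 1)).
    { intros z. unfold logF, Rdiv. apply Rmult_comm. }
    now apply is_derive_scal, is_derive_pow_ln.
  - unfold logf. rewrite Nat.add_sub. field.
    split; [lra | apply not_0_INR; lia].
Qed.

Lemma is_derive_logf (k : nat) (y : R) : 0 < y -> is_derive (logf k) y (logf' k y).
Proof.
  intros Hy.
  replace (logf' k y) with
    ((INR k * ln y ^ (k - 1) / y * y - ln y ^ k * 1) / y ^ 2).
  - apply (is_derive_div (fun z => ln z ^ k) (fun z => z)); [| |lra].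
    + now apply is_derive_pow_ln.
    + apply (is_derive_id (K := R_AbsRing)).
  - unfold logf'. field. lra.
Qed.

Lemma is_derive_logf' (k : nat) (y : R) : 0 < y -> is_derive (logf' k) y (logf'' k y).
Proof.
  intros Hy.
  replace (logf'' k y) with
    (((INR k * (INR (k - 1) * ln y ^ (k - 1 - 1) / y) - INR k * ln y ^ (k - 1) / y) * y ^ 2
      - (INR k * ln y ^ (k - 1) - ln y ^ k) * (INR 2 * 1 * y ^ 1)) / (y ^ 2) ^ 2).
  - apply (is_derive_div (fun z => INR k * ln z ^ (k - 1) - ln z ^ k) (fun z => z ^ 2)).
    + apply (is_derive_minus (fun z => INR k * ln z ^ (k - 1)) (fun z => ln z ^ k)).
      * now apply is_derive_scal, is_derive_pow_ln.
      * now apply is_derive_pow_ln.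
    + apply (is_derive_pow (fun z => z) 2 y 1). apply (is_derive_id (K := R_AbsRing)).
    + apply pow_nonzero. lra.
  - unfold logf''.
    replace (INR k * (INR k - 1) * ln y ^ (k - 2))
      with (INR k * INR (k - 1) * ln y ^ (k - 1 - 1)).
    + simpl INR. field. lra.
    + destruct k as [|k]; [simpl; ring|].
      replace (S k - 1 - 1)%nat with (S k - 2)%nat by lia.
      rewrite S_INR, <- (Nat.add_1_r k), Nat.add_sub. ring.
Qed.

(** With z = |ln y| / 2, the single Taylor term z^k / k! is at most exp z. This exponential is sqrt
    y or 1 / sqrt y, and both are at most sqrt y / delta because delta <= 1 and delta <= y. *)
Lemma pow_ln_bound (delta y : R) (k : nat) : 0 < delta <= 1 -> delta <= y ->
  Rabs (ln y) ^ k <= INR (fact k) * 2 ^ k * (sqrt y / delta).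
Proof.
  intros Hd Hy. set (z := Rabs (ln y) / 2).
  assert (Hz : 0 <= z) by (unfold z; generalize (Rabs_pos (ln y)); lra).
  assert (Hf := INR_fact_lt_0 k).
  assert (H1 : z ^ k / INR (fact k) <= exp z).
  { apply Rle_trans with (2 := exp_ge_taylor z k Hz).
    destruct k as [|k]; [simpl; lra|]. rewrite tech5.
    assert (0 <= sum_f_R0 (fun j => z ^ j / INR (fact j)) k); [|lra].
    apply cond_pos_sum. intros j. apply Rdiv_le_0_compat.
    - now apply pow_le.
    - apply INR_fact_lt_0. }
  assert (Hs : 0 < sqrt y) by (apply sqrt_lt_R0; lra).
  assert (Hss : sqrt y * sqrt y = y) by (apply sqrt_sqrt; lra).
  assert (Hq : exp (ln y / 2) = sqrt y).
  { rewrite <- Rpower_sqrt by lra. unfold Rpower. f_equal. field. }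
  assert (H2 : exp z <= sqrt y / delta).
  { unfold z, Rabs. destruct (Rcase_abs (ln y)) as [Hn|Hn].
    - replace (- ln y / 2) with (- (ln y / 2)) by field.
      rewrite exp_Ropp, Hq.
      apply Rmult_le_reg_r with (sqrt y * delta); [nra|].
      replace (/ sqrt y * (sqrt y * delta)) with delta by (field; lra).
      replace (sqrt y / delta * (sqrt y * delta)) with (sqrt y * sqrt y) by (field; lra).
      lra.
    - rewrite Hq. apply Rmult_le_reg_r with delta; [lra|].
      replace (sqrt y / delta * delta) with (sqrt y) by (field; lra). nra. }
  replace (Rabs (ln y) ^ k) with (INR (fact k) * 2 ^ k * (z ^ k / INR (fact k))).
  - apply Rmult_le_compat_l; [|lra].
    apply Rmult_le_pos; [lra|]. apply pow_le; lra.
  - replace (Rabs (ln y)) with (2 * z) by (unfold z; field).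
    rewrite Rpow_mult_distr. field. lra.
Qed.

(* The growth k! 2^k, which makes all the generating functions below converge for
   |t| < 1/2, comes from |ln y|^k <= k! 2^k exp(|ln y| / 2). *)
Definition bnd (k : nat) (delta : R) : R := 4 * (INR (fact k) * 2 ^ k) / delta.

Lemma bnd_pos (k : nat) (delta : R) : 0 < delta -> 0 < bnd k delta.
Proof.
  intros Hd. unfold bnd. apply Rdiv_lt_0_compat; [|exact Hd].
  assert (H := INR_fact_lt_0 k). assert (H2 := pow_lt 2 k ltac:(lra)). nra.
Qed.

(** Each factor k, k - 1 that comes with a lowered exponent restores k! and costs one 2, whence the
    bounds M, M/2, M/4. The worst numerator, that of [logf''], is at most M/4 + 3M/2 + 2M <= 4M:
    this is the 4 in [bnd]. *)
Lemma logf_bounds (delta y : R) (k : nat) : 0 < delta <= 1 -> delta <= y ->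
  Rabs (logf k y) <= bnd k delta / sqrt y /\
  Rabs (logf' k y) <= bnd k delta / (y * sqrt y) /\
  Rabs (logf'' k y) <= bnd k delta / (y ^ 2 * sqrt y).
Proof.
  intros Hd Hy.
  set (M := INR (fact k) * 2 ^ k * (sqrt y / delta)).
  assert (Hs : 0 < sqrt y) by (apply sqrt_lt_R0; lra).
  assert (Hss : sqrt y * sqrt y = y) by (apply sqrt_sqrt; lra).
  assert (HM : 0 <= M).
  { unfold M. assert (H := INR_fact_lt_0 k). assert (H2 := pow_lt 2 k ltac:(lra)).
    apply Rmult_le_pos; [nra|]. apply Rlt_le, Rdiv_lt_0_compat; lra. }
  assert (H0 : Rabs (ln y ^ k) <= M).
  { rewrite <- RPow_abs. now apply pow_ln_bound. }
  assert (H1 : Rabs (INR k * ln y ^ (k - 1)) <= M / 2).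
  { destruct k as [|k]; [simpl; rewrite Rmult_0_l, Rabs_R0; lra|].
    rewrite <- (Nat.add_1_r k), Nat.add_sub, Nat.add_1_r.
    rewrite Rabs_mult, (Rabs_right (INR (S k))) by apply Rle_ge, pos_INR.
    rewrite <- RPow_abs.
    replace (M / 2) with (INR (S k) * (INR (fact k) * 2 ^ k * (sqrt y / delta))).
    - apply Rmult_le_compat_l; [apply pos_INR|]. now apply pow_ln_bound.
    - unfold M. rewrite fact_simpl, mult_INR. simpl pow. field. lra. }
  assert (H2 : Rabs (INR k * (INR k - 1) * ln y ^ (k - 2)) <= M / 4).
  { destruct k as [|[|k]].
    - simpl INR. rewrite !Rmult_0_l, Rabs_R0; lra.
    - simpl INR. replace (1 * (1 - 1) * ln y ^ (1 - 2)) with 0 by ring.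
      rewrite Rabs_R0; lra.
    - replace (S (S k) - 2)%nat with k by lia.
      replace (INR (S (S k)) - 1) with (INR (S k)) by (rewrite (S_INR (S k)); ring).
      rewrite Rabs_mult, <- RPow_abs.
      rewrite (Rabs_right (INR (S (S k)) * INR (S k)))
        by (apply Rle_ge, Rmult_le_pos; apply pos_INR).
      replace (M / 4) with
        (INR (S (S k)) * INR (S k) * (INR (fact k) * 2 ^ k * (sqrt y / delta))).
      + apply Rmult_le_compat_l; [apply Rmult_le_pos; apply pos_INR|].
        now apply pow_ln_bound.
      + unfold M. rewrite !fact_simpl, !mult_INR. simpl pow. field. lra. }
  apply Rabs_le_between in H0. apply Rabs_le_between in H1. apply Rabs_le_between in H2.
  assert (Hdiv : forall a p : R, 0 < p -> Rabs a <= 4 * M ->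
            Rabs (a / p) <= bnd k delta * (sqrt y / p)).
  { intros a p Hp Ha. unfold Rdiv at 1. rewrite Rabs_mult, (Rabs_right (/ p)).
    2:{ apply Rle_ge, Rlt_le, Rinv_0_lt_compat, Hp. }
    replace (bnd k delta * (sqrt y / p)) with (4 * M * / p).
    - apply Rmult_le_compat_r; [|exact Ha]. apply Rlt_le, Rinv_0_lt_compat, Hp.
    - unfold bnd, M. field. lra. }
  assert (Hq : forall p q, p <> 0 -> q <> 0 -> p = q * sqrt y ->
            bnd k delta * (sqrt y / p) = bnd k delta / q).
  { intros p q Hp Hq0 ->. field. lra. }
  assert (Hy2 := pow_lt y 2 ltac:(lra)). assert (Hy3 := pow_lt y 3 ltac:(lra)).
  unfold logf, logf', logf''. split; [|split].
  - rewrite <- (Hq y); try lra. apply Hdiv; [lra|]. apply Rabs_le. lra.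
  - rewrite <- (Hq (y ^ 2)); try nra. apply Hdiv; [lra|]. apply Rabs_le. lra.
  - rewrite <- (Hq (y ^ 3)); try nra. apply Hdiv; [lra|]. apply Rabs_le. lra.
Qed.

(** Two uses of the mean value theorem turn the remainder into g'' d * (c - y) with 0 <= c - y <=
    1. *)
Lemma Rabs_taylor1_unit_step (g g' g'' : R -> R) (y K : R) :
  (forall z, y <= z <= y + 1 -> is_derive g z (g' z)) ->
  (forall z, y <= z <= y + 1 -> is_derive g' z (g'' z)) ->
  (forall z, y <= z <= y + 1 -> Rabs (g'' z) <= K) ->
  Rabs (g (y + 1) - g y - g' y) <= K.
Proof.
  intros H1 H2 HK.
  destruct (MVT_gen g y (y + 1) g') as [c [Hc Ec]].
  { intros z Hz. rewrite Rmin_left, Rmax_right in Hz by lra. apply H1. lra. }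
  { intros z Hz. rewrite Rmin_left, Rmax_right in Hz by lra.
    apply continuity_pt_filterlim, (ex_derive_continuous g).
    eexists. apply H1. lra. }
  rewrite Rmin_left, Rmax_right in Hc by lra.
  destruct (MVT_gen g' y c g'') as [d [Hd Ed]].
  { intros z Hz. rewrite Rmin_left, Rmax_right in Hz by lra. apply H2. lra. }
  { intros z Hz. rewrite Rmin_left, Rmax_right in Hz by lra.
    apply continuity_pt_filterlim, (ex_derive_continuous g').
    eexists. apply H2. lra. }
  rewrite Rmin_left, Rmax_right in Hd by lra.
  replace (g (y + 1) - g y - g' y) with (g'' d * (c - y)) by lra.
  rewrite Rabs_mult, (Rabs_right (c - y)) by lra.
  generalize (HK d ltac:(lra)) (Rabs_pos (g'' d)). intros. nra.
Qed.

(* First-order Euler-Maclaurin remainders of [logF k] and [logf k]: summing [emD k]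
   over y, y+1, ... gives psi_k(y) - log^(k+1)(y)/(k+1), see [psi_emR]. *)
Definition emD (k : nat) (y : R) : R := logF k (y + 1) - logF k y - logf k y.
Definition emD' (k : nat) (y : R) : R := logf k (y + 1) - logf k y - logf' k y.

Lemma is_derive_emD (k : nat) (y : R) : 0 < y -> is_derive (emD k) y (emD' k y).
Proof.
  intros Hy. unfold emD, emD'.
  apply (is_derive_minus (fun z => logF k (z + 1) - logF k z) (logf k)).
  - apply (is_derive_minus (fun z => logF k (z + 1)) (logF k)).
    + replace (logf k (y + 1)) with (1 * logf k (y + 1)) by ring.
      apply (is_derive_comp (logF k) (fun z => z + 1) y (logf k (y + 1)) 1).
      * apply is_derive_logF. lra.
      * auto_derive; auto.
    + now apply is_derive_logF.
  - now apply is_derive_logf.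
Qed.

Lemma div_pow_sqrt_antitone (B y z : R) (i : nat) : 0 < B -> 0 < y <= z ->
  B / (z ^ i * sqrt z) <= B / (y ^ i * sqrt y).
Proof.
  intros HB Hyz.
  assert (Hs : 0 < sqrt y) by (apply sqrt_lt_R0; lra).
  assert (Hp := pow_lt y i ltac:(lra)).
  apply Rmult_le_compat_l; [lra|]. apply Rinv_le_contravar; [nra|].
  apply Rmult_le_compat; try lra.
  - apply pow_incr. lra.
  - apply sqrt_le_1; lra.
Qed.

Lemma emD_bounds (delta y : R) (k : nat) : 0 < delta <= 1 -> delta <= y ->
  Rabs (emD k y) <= bnd k delta / (y * sqrt y) /\
  Rabs (emD' k y) <= bnd k delta / (y ^ 2 * sqrt y).
Proof.
  intros Hd Hy. assert (HB := bnd_pos k delta ltac:(lra)). split.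
  - apply (Rabs_taylor1_unit_step (logF k) (logf k) (logf' k)).
    + intros z Hz. apply is_derive_logF. lra.
    + intros z Hz. apply is_derive_logf. lra.
    + intros z Hz.
      apply Rle_trans with (bnd k delta / (z * sqrt z)).
      * apply logf_bounds; lra.
      * generalize (div_pow_sqrt_antitone (bnd k delta) y z 1). rewrite !pow_1.
        intros H. apply H; lra.
  - apply (Rabs_taylor1_unit_step (logf k) (logf' k) (logf'' k)).
    + intros z Hz. apply is_derive_logf. lra.
    + intros z Hz. apply is_derive_logf'. lra.
    + intros z Hz.
      apply Rle_trans with (bnd k delta / (z ^ 2 * sqrt z)).
      * apply logf_bounds; lra.
      * apply div_pow_sqrt_antitone; lra.
Qed.

(** Discrete counterparts of the integrals of y^(-3/2) and y^(-5/2). With a = sqrt y and b = sqrt (y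
    + 1), 1/a - 1/b = 1 / (a b (a + b)) >= 1 / (2 a b^2); the factor 1 + 1/delta pays for replacing
    y + 1 by y. *)
Lemma telescope_bounds (delta y : R) : 0 < delta -> delta <= y ->
  1 / (y * sqrt y) <= 2 * (1 + / delta) * (/ sqrt y - / sqrt (y + 1)) /\
  1 / (y ^ 2 * sqrt y)
  <= (1 + / delta) * (/ (y * sqrt y) - / ((y + 1) * sqrt (y + 1))).
Proof.
  intros Hd Hy.
  assert (Ha : 0 < sqrt y) by (apply sqrt_lt_R0; lra).
  assert (Haa : sqrt y * sqrt y = y) by (apply sqrt_sqrt; lra).
  assert (Hb : 0 < sqrt (y + 1)) by (apply sqrt_lt_R0; lra).
  assert (Hbb : sqrt (y + 1) * sqrt (y + 1) = y + 1) by (apply sqrt_sqrt; lra).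
  assert (Hab : sqrt y <= sqrt (y + 1)) by (apply sqrt_le_1; lra).
  assert (HK : y + 1 <= (1 + / delta) * y).
  { assert (1 <= / delta * y); [|lra].
    apply Rmult_le_reg_l with delta; [lra|].
    rewrite <- Rmult_assoc, Rinv_r; lra. }
  assert (HKp : 0 < / delta) by (apply Rinv_0_lt_compat; lra).
  set (K := 1 + / delta) in *. set (a := sqrt y) in *. set (b := sqrt (y + 1)) in *.
  assert (Hy0 : 0 < y) by lra.
  assert (Hya : 0 < y * a) by (apply Rmult_lt_0_compat; lra).
  split.
  - replace (/ a - / b) with (1 / (a * b * (a + b))).
    2:{ replace 1 with (b * b - a * a) by lra. field. lra. }
    apply Rle_trans with (2 * K * (1 / (2 * (a * (b * b))))).
    + rewrite Hbb. apply Rmult_le_reg_r with (y * a * (y + 1)); [|].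
      { apply Rmult_lt_0_compat; nra. }
      replace (1 / (y * a) * (y * a * (y + 1))) with (y + 1) by (field; lra).
      replace (2 * K * (1 / (2 * (a * (y + 1)))) * (y * a * (y + 1))) with (K * y)
        by (field; lra).
      exact HK.
    + apply Rmult_le_compat_l; [unfold K; lra|]. unfold Rdiv.
      apply Rmult_le_compat_l; [lra|]. apply Rinv_le_contravar.
      * apply Rmult_lt_0_compat; nra.
      * assert (0 < a * b) by nra. nra.
  - apply Rle_trans with (K * (/ (y * a) - / ((y + 1) * a))).
    + replace (/ (y * a) - / ((y + 1) * a)) with (1 / (y * a * (y + 1))) by (field; lra).
      apply Rmult_le_reg_r with (y ^ 2 * a * (y + 1)); [|].
      { apply Rmult_lt_0_compat; nra. }
      replace (1 / (y ^ 2 * a) * (y ^ 2 * a * (y + 1))) with (y + 1) by (field; lra).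
      replace (K * (1 / (y * a * (y + 1))) * (y ^ 2 * a * (y + 1))) with (K * y)
        by (field; lra).
      exact HK.
    + apply Rmult_le_compat_l; [unfold K; lra|].
      assert (/ ((y + 1) * b) <= / ((y + 1) * a)); [|lra].
      apply Rinv_le_contravar; nra.
Qed.

Definition emR (k : nat) (y : R) : R := Series (fun m => emD k (INR m + y)).
Definition emR' (k : nat) (y : R) : R := Series (fun m => emD' k (INR m + y)).

Lemma ex_series_weights (delta : R) : 0 < delta ->
  ex_series (fun m => 1 / ((INR m + delta) * sqrt (INR m + delta))) /\
  ex_series (fun m => 1 / ((INR m + delta) ^ 2 * sqrt (INR m + delta))).
Proof.
  intros Hd.
  assert (Hm : forall m, delta <= INR m + delta) by (intros m; generalize (pos_INR m); lra).
  assert (Hs : forall m, 0 < sqrt (INR m + delta)).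
  { intros m. apply sqrt_lt_R0. generalize (Hm m). lra. }
  assert (Hi : 0 < / delta) by now apply Rinv_0_lt_compat.
  assert (Hstep : forall m, INR (S m) + delta = INR m + delta + 1)
    by (intros; rewrite S_INR; ring).
  split.
  - apply ex_series_Rabs, (fun a => ex_series_Rabs_telescope a
      (fun m => 2 * (1 + / delta) * / sqrt (INR m + delta))).
    + intros n. rewrite Hstep, Rabs_right.
      * rewrite <- Rmult_minus_distr_l. now apply telescope_bounds.
      * apply Rle_ge, Rlt_le, Rdiv_lt_0_compat; [lra|].
        generalize (Hm n) (Hs n). intros. nra.
    + intros n. apply Rmult_le_pos; [lra|]. now apply Rlt_le, Rinv_0_lt_compat.
  - apply ex_series_Rabs, (fun a => ex_series_Rabs_telescope a
      (fun m => (1 + / delta) * / ((INR m + delta) * sqrt (INR m + delta)))).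
    + intros n. rewrite Hstep, Rabs_right.
      * rewrite <- Rmult_minus_distr_l. now apply telescope_bounds.
      * apply Rle_ge, Rlt_le, Rdiv_lt_0_compat; [lra|].
        generalize (Hm n) (Hs n). intros. apply Rmult_lt_0_compat; [nra|lra].
    + intros n. apply Rmult_le_pos; [lra|]. apply Rlt_le, Rinv_0_lt_compat.
      generalize (Hm n) (Hs n). intros. nra.
Qed.

(** The exponents -1/2 and -3/2 are what the sums over multiples require: at y = n x, both emR / n
    and emR' are O(n^(-3/2)). *)
Lemma emR_bounds (delta y : R) (k : nat) : 0 < delta <= 1 -> delta <= y ->
  ex_series (fun m => emD k (INR m + y)) /\
  Rabs (emR k y) <= bnd k delta * (2 * (1 + / delta)) * / sqrt y /\
  ex_series (fun m => emD' k (INR m + y)) /\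
  Rabs (emR' k y) <= bnd k delta * (1 + / delta) * / (y * sqrt y).
Proof.
  intros Hd Hy. assert (HB := bnd_pos k delta ltac:(lra)).
  assert (Hi : 0 < / delta) by (apply Rinv_0_lt_compat; lra).
  assert (Hm : forall m, delta <= INR m + y) by (intros m; generalize (pos_INR m); lra).
  assert (Hs : forall m, 0 < sqrt (INR m + y)).
  { intros m. apply sqrt_lt_R0. generalize (Hm m). lra. }
  assert (Hstep : forall m, INR (S m) + y = INR m + y + 1)
    by (intros; rewrite S_INR; ring).
  destruct (ex_series_Rabs_telescope (fun m => emD k (INR m + y))
    (fun m => bnd k delta * (2 * (1 + / delta)) * / sqrt (INR m + y))) as [E1 L1].
  { intros m. rewrite Hstep, <- Rmult_minus_distr_l, Rmult_assoc.
    apply Rle_trans with (1 := proj1 (emD_bounds delta _ k Hd (Hm m))).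
    unfold Rdiv. rewrite <- (Rmult_1_l (/ _)).
    apply Rmult_le_compat_l; [lra|]. now apply telescope_bounds. }
  { intros m. apply Rmult_le_pos; [apply Rmult_le_pos; lra|].
    now apply Rlt_le, Rinv_0_lt_compat. }
  destruct (ex_series_Rabs_telescope (fun m => emD' k (INR m + y))
    (fun m => bnd k delta * (1 + / delta) * / ((INR m + y) * sqrt (INR m + y))))
    as [E2 L2].
  { intros m. rewrite Hstep, <- Rmult_minus_distr_l, Rmult_assoc.
    apply Rle_trans with (1 := proj2 (emD_bounds delta _ k Hd (Hm m))).
    unfold Rdiv. rewrite <- (Rmult_1_l (/ _)).
    apply Rmult_le_compat_l; [lra|]. now apply telescope_bounds. }
  { intros m. apply Rmult_le_pos; [apply Rmult_le_pos; lra|].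
    apply Rlt_le, Rinv_0_lt_compat. generalize (Hm m) (Hs m). intros. nra. }
  simpl INR in L1, L2. rewrite Rplus_0_l in L1, L2.
  repeat split; try assumption.
  - now apply ex_series_Rabs.
  - now apply ex_series_Rabs.
Qed.

Lemma is_derive_emR (k : nat) (y : R) : 0 < y -> is_derive (emR k) y (emR' k y).
Proof.
  intros Hy. assert (Hr : 0 < y / 2) by lra.
  (* Every z with |z - y| < y / 2 satisfies z >= delta, so one summable weight serves the whole
     ball. *)
  set (delta := Rmin 1 (y / 2)).
  assert (Hd : 0 < delta <= 1) by (split; [apply Rmin_pos; lra | apply Rmin_l]).
  assert (Hd2 : delta <= y / 2) by apply Rmin_r.
  apply (is_derive_Series (fun m z => emD k (INR m + z)) (fun m z => emD' k (INR m + z))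
    (fun m => bnd k delta * (1 / ((INR m + delta) ^ 2 * sqrt (INR m + delta))))
    y (mkposreal _ Hr)).
  - intros n z Hz. simpl in Hz. apply Rabs_def2 in Hz. assert (Hn := pos_INR n).
    replace (emD' k (INR n + z)) with (1 * emD' k (INR n + z)) by ring.
    apply (is_derive_comp (emD k) (fun z => INR n + z) z (emD' k (INR n + z)) 1).
    + apply is_derive_emD. lra.
    + auto_derive; auto.
  - intros n z Hz. simpl in Hz. apply Rabs_def2 in Hz. assert (Hn := pos_INR n).
    apply Rle_trans with (bnd k delta / ((INR n + z) ^ 2 * sqrt (INR n + z))).
    + apply emD_bounds; lra.
    + unfold Rdiv at 2. rewrite Rmult_1_l.
      apply div_pow_sqrt_antitone; [apply bnd_pos; lra|lra].
  - intros z Hz. simpl in Hz. apply Rabs_def2 in Hz.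
    apply (fun H H' => proj1 (emR_bounds delta z k H H')); lra.
  - apply ex_series_scal_R, ex_series_weights. lra.
Qed.

(** * Laurent expansion of zeta *)

Lemma is_lim_seq_INR_plus (y : R) : is_lim_seq (fun n => INR n + y) p_infty.
Proof.
  eapply is_lim_seq_plus; [apply is_lim_seq_INR | apply is_lim_seq_const | easy].
Qed.

(** Both terms diverge, but by the mean value theorem their difference is y * logf k c with c >= n,
    hence O(1 / sqrt n). *)
Lemma is_lim_seq_logF_shift (k : nat) (y : R) : 0 < y ->
  is_lim_seq (fun n => logF k (INR n + y) - logF k (INR n)) 0.
Proof.
  intros Hy. apply is_lim_seq_abs_0.
  assert (HB := bnd_pos k 1 ltac:(lra)).
  apply is_lim_seq_incr_1.
  apply (is_lim_seq_le_le (fun _ => 0) _ (fun n => y * (bnd k 1 * / sqrt (INR (S n))))).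
  - intros n. split; [apply Rabs_pos|].
    assert (Hn : 1 <= INR (S n)) by (rewrite S_INR; generalize (pos_INR n); lra).
    destruct (MVT_gen (logF k) (INR (S n)) (INR (S n) + y) (logf k)) as [c [Hc Ec]].
    { intros z Hz. rewrite Rmin_left, Rmax_right in Hz by lra.
      apply is_derive_logF. lra. }
    { intros z Hz. rewrite Rmin_left, Rmax_right in Hz by lra.
      apply continuity_pt_filterlim, (ex_derive_continuous (logF k)).
      eexists. apply is_derive_logF. lra. }
    rewrite Rmin_left, Rmax_right in Hc by lra.
    rewrite Ec. replace (INR (S n) + y - INR (S n)) with y by ring.
    rewrite Rmult_comm, Rabs_mult, (Rabs_right y) by lra.
    apply Rmult_le_compat_l; [lra|].
    destruct (logf_bounds 1 c k) as [H _]; try lra.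
    apply Rle_trans with (1 := H). apply Rmult_le_compat_l; [lra|].
    apply Rinv_le_contravar; [apply sqrt_lt_R0; lra | apply sqrt_le_1; lra].
  - apply is_lim_seq_const.
  - replace (Finite 0) with (Finite (y * (bnd k 1 * 0))) by (f_equal; ring).
    apply is_lim_seq_mult'; [apply is_lim_seq_const|].
    apply is_lim_seq_mult'; [apply is_lim_seq_const|].
    apply (is_lim_seq_incr_1 (fun n => / sqrt (INR n))).
    change (Finite 0) with (Rbar_inv p_infty). apply is_lim_seq_inv; [|easy].
    apply filterlim_comp with (2 := filterlim_sqrt_p). apply is_lim_seq_INR.
Qed.

(** The power y^(-u), spelled as exp (ln y * t) at t = -u to match the generating functions. *)
Definition pw (u y : R) : R := exp (ln y * - u).

Lemma pw_pos (u y : R) : 0 < pw u y.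
Proof. apply exp_pos. Qed.

Lemma pw_mult (u y z : R) : 0 < y -> 0 < z -> pw u (y * z) = pw u y * pw u z.
Proof. intros Hy Hz. unfold pw. rewrite ln_mult, <- exp_plus by auto. f_equal. ring. Qed.

Lemma is_lim_seq_pw (u y : R) : 0 < u -> is_lim_seq (fun n => pw u (INR n + y)) 0.
Proof.
  intros Hu. unfold pw.
  apply (is_lim_seq_ext (fun n => / exp (ln (INR n + y) * u))).
  { intros n. rewrite <- exp_Ropp. f_equal. ring. }
  change (Finite 0) with (Rbar_inv p_infty). apply is_lim_seq_inv; [|easy].
  apply (filterlim_comp _ _ _ _ exp _ (Rbar_locally' p_infty) _); [|exact is_lim_exp_p].
  apply (is_lim_seq_ext (fun n => u * ln (INR n + y)) _ p_infty); [intros; ring|].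
  replace p_infty with (Rbar_mult u p_infty).
  - apply is_lim_seq_scal_l.
    apply (filterlim_comp _ _ _ _ ln _ (Rbar_locally' p_infty) _); [|exact is_lim_ln_p].
    apply is_lim_seq_INR_plus.
  - simpl. destruct (Rle_dec 0 u) as [H|H]; [|lra].
    destruct (Rle_lt_or_eq_dec 0 u H); [easy|lra].
Qed.

Lemma is_lim_seq_pw_div (u y : R) : 0 < u ->
  is_lim_seq (fun n => pw u (INR n + y) / (INR n + y)) 0.
Proof.
  intros Hu. replace (Finite 0) with (Finite (0 * 0)) by (f_equal; ring).
  apply is_lim_seq_mult'; [now apply is_lim_seq_pw|].
  change (Finite 0) with (Rbar_inv p_infty). apply is_lim_seq_inv; [|easy].
  apply is_lim_seq_INR_plus.
Qed.

Lemma is_series_logf_egf (y t : R) :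
  is_series (fun k => logf k y / INR (fact k) * t ^ k) (exp (ln y * t) / y).
Proof.
  apply is_series_ext_R with (fun k => / y * (/ INR (fact k) * (ln y * t) ^ k)).
  - intros k. unfold logf, Rdiv. rewrite Rpow_mult_distr. ring.
  - unfold Rdiv. rewrite (Rmult_comm (exp _)). apply is_series_scal_R, is_series_exp.
Qed.

(** The value is (t - 1) y^(t-2), the y-derivative of the generating function y^(t-1) of [logf]. *)
Lemma is_series_logf'_egf (y t : R) : 0 < y ->
  is_series (fun k => logf' k y / INR (fact k) * t ^ k)
    ((t - 1) * exp (ln y * t) / y ^ 2).
Proof.
  intros Hy.
  assert (E1 : is_series (fun k => / y ^ 2 * (INR k * ln y ^ (k - 1) / INR (fact k) * t ^ k))
            (/ y ^ 2 * (t * exp (ln y * t)))).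
  { apply is_series_scal_R. apply is_series_decr_1.
    replace (plus _ _) with (t * exp (ln y * t))
      by (unfold plus, opp; simpl; unfold Rdiv; ring).
    apply is_series_ext_R with (fun k => t * (/ INR (fact k) * (ln y * t) ^ k)).
    - intros k. rewrite fact_simpl, mult_INR, Rpow_mult_distr.
      replace (S k - 1)%nat with k by lia. simpl pow.
      generalize (INR_fact_neq_0 k) (not_0_INR (S k) ltac:(lia)). intros.
      field. auto.
    - apply is_series_scal_R, is_series_exp. }
  assert (E2 := is_series_scal_R (- / y) _ _ (is_series_logf_egf y t)).
  replace ((t - 1) * exp (ln y * t) / y ^ 2) with
    (plus (/ y ^ 2 * (t * exp (ln y * t))) (- / y * (exp (ln y * t) / y)))
    by (unfold plus; simpl; field; lra).
  apply is_series_ext_R with (2 := is_series_plus _ _ _ _ E1 E2).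
  intros k. unfold plus, logf', logf; simpl. field.
  split; [lra | apply INR_fact_neq_0].
Qed.

Lemma is_series_minus_R (a b : nat -> R) (la lb : R) :
  is_series a la -> is_series b lb -> is_series (fun n => a n - b n) (la - lb).
Proof. exact (@is_series_minus R_AbsRing R_NormedModule a b la lb). Qed.

(** The remainder of y^(-1-u), with antiderivative y^(-u) / (-u); the constants -1 in the two [logF]
    series cancel. *)
Lemma is_series_emD_egf (u y : R) : 0 < u ->
  is_series (fun k => emD k y / INR (fact k) * (- u) ^ k)
    ((pw u (y + 1) - pw u y) / - u - pw u y / y).
Proof.
  intros Hu.
  replace ((pw u (y + 1) - pw u y) / - u) with
    ((exp (ln (y + 1) * - u) - 1) / - u - (exp (ln y * - u) - 1) / - u)
    by (unfold pw; field; lra).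
  apply is_series_ext_R with (2 := is_series_minus_R _ _ _ _ (is_series_minus_R _ _ _ _
    (is_series_expm1_div (ln (y + 1)) (- u) ltac:(lra))
    (is_series_expm1_div (ln y) (- u) ltac:(lra)))
    (is_series_logf_egf y (- u))).
  intros k. unfold emD, logF, Rdiv. ring.
Qed.

Lemma is_series_emD'_egf (u y : R) : 0 < y ->
  is_series (fun k => emD' k y / INR (fact k) * (- u) ^ k)
    (pw u (y + 1) / (y + 1) - pw u y / y + (1 + u) * (pw u y / y ^ 2)).
Proof.
  intros Hy.
  replace (pw u (y + 1) / (y + 1) - pw u y / y + (1 + u) * (pw u y / y ^ 2)) with
    (exp (ln (y + 1) * - u) / (y + 1) - exp (ln y * - u) / y
     - (- u - 1) * exp (ln y * - u) / y ^ 2) by (unfold pw; field; lra).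
  apply is_series_ext_R with (2 := is_series_minus_R _ _ _ _ (is_series_minus_R _ _ _ _
    (is_series_logf_egf (y + 1) (- u)) (is_series_logf_egf y (- u)))
    (is_series_logf'_egf y (- u) Hy)).
  intros k. unfold emD', Rdiv. ring.
Qed.

(** Against t^k / k!, the growth k! 2^k leaves the product majorant (2 |t|)^k * v n, summable
    exactly because |t| < 1/2. *)
Lemma is_series_egf_Series (d : nat -> nat -> R) (h v : nat -> R) (t : R) :
  Rabs t < / 2 ->
  (forall k n, Rabs (d k n) <= INR (fact k) * 2 ^ k * v n) -> ex_series v ->
  (forall n, is_series (fun k => d k n / INR (fact k) * t ^ k) (h n)) ->
  is_series (fun k => Series (d k) / INR (fact k) * t ^ k) (Series h) /\ ex_series h.
Proof.
  intros Ht Hd Ev Hh.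
  assert (Hb : forall k n, Rabs (d k n / INR (fact k) * t ^ k) <= (2 * Rabs t) ^ k * v n).
  { intros k n. assert (Hf := INR_fact_lt_0 k).
    unfold Rdiv. rewrite !Rabs_mult, <- RPow_abs.
    rewrite (Rabs_right (/ _)) by now apply Rle_ge, Rlt_le, Rinv_0_lt_compat.
    replace ((2 * Rabs t) ^ k * v n)
      with (INR (fact k) * 2 ^ k * v n * / INR (fact k) * Rabs t ^ k)
      by (rewrite Rpow_mult_distr; field; lra).
    apply Rmult_le_compat_r; [apply pow_le, Rabs_pos|].
    apply Rmult_le_compat_r; [now apply Rlt_le, Rinv_0_lt_compat|]. apply Hd. }
  assert (Eg : ex_series (fun k => (2 * Rabs t) ^ k)).
  { apply ex_series_geom. rewrite Rabs_right; [lra|].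
    generalize (Rabs_pos t). lra. }
  split.
  - rewrite (Series_ext h (fun n => Series (fun k => d k n / INR (fact k) * t ^ k)))
      by (intros n; symmetry; apply is_series_unique, Hh).
    apply is_series_ext_R with (2 := is_series_swap _ _ _ Hb Eg Ev).
    intros k. unfold Rdiv. now rewrite !Series_scal_r.
  - apply ex_series_dominated with (fun n => Series (fun k => (2 * Rabs t) ^ k) * v n).
    + intros n. rewrite <- (is_series_unique _ _ (Hh n)), <- Series_scal_r.
      apply Series_dominated; [intros k; apply Hb|].
      apply ex_series_ext_R with (fun k => v n * (2 * Rabs t) ^ k).
      * intros; ring.
      * now apply ex_series_scal_R.
    + now apply ex_series_scal_R.
Qed.

(** The classical limit for gamma_k: the negated partial sums are sum_(n <= N) log^k(n)/n -
    log^(k+1)(N+1)/(k+1). *)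
Definition emG (k : nat) : R := - Series (fun n => emD k (INR n + 1)).

(** In the sum of the remainders of y^(-1-u) over y = 1, 2, ..., the differences of powers telescope
    to 1/u, the pole, and the rest is -zeta(1+u). Convergence of the Dirichlet series falls out of
    the same computation. *)
Lemma zeta_expansion (u : R) : 0 < u < / 2 ->
  is_series (fun n => pw u (INR n + 1) / (INR n + 1)) (zeta (1 + u)) /\
  is_series (fun k => (-1) ^ k * emG k / INR (fact k) * u ^ k) (zeta (1 + u) - 1 / u).
Proof.
  intros Hu.
  assert (Hw := proj1 (ex_series_weights 1 ltac:(lra))).
  set (h := fun n => (pw u (INR n + 1 + 1) - pw u (INR n + 1)) / - u
                     - pw u (INR n + 1) / (INR n + 1)).
  destruct (is_series_egf_Series (fun k n => emD k (INR n + 1)) h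
    (fun n => 4 * (1 / ((INR n + 1) * sqrt (INR n + 1)))) (- u)) as [E1 E2].
  - rewrite Rabs_left; lra.
  - intros k n. assert (Hn := pos_INR n).
    apply Rle_trans with (1 := proj1 (emD_bounds 1 (INR n + 1) k ltac:(lra) ltac:(lra))).
    right. unfold bnd. field. assert (0 < sqrt (INR n + 1)) by (apply sqrt_lt_R0; lra). lra.
  - now apply ex_series_scal_R.
  - intros n. apply is_series_emD_egf. lra.
  - assert (T : is_series (fun n => pw u (INR n + 1) / (INR n + 1)) (1 / u - Series h)).
    { replace (1 / u) with (0 / - u - pw u (INR 0 + 1) / - u).
      2:{ unfold pw. simpl INR. rewrite Rplus_0_l, ln_1, Rmult_0_l, exp_0. field. lra. }
      assert (L : is_lim_seq (fun n => pw u (INR n + 1) / - u) (0 / - u)).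
      { apply is_lim_seq_mult'; [apply is_lim_seq_pw; lra | apply is_lim_seq_const]. }
      apply is_series_ext_R with
        (2 := is_series_minus_R _ _ _ _ (is_series_telescope _ _ L) (Series_correct _ E2)).
      intros n. unfold h. rewrite S_INR. field. generalize (pos_INR n). lra. }
    assert (Z : zeta (1 + u) = 1 / u - Series h).
    { rewrite <- (is_series_unique _ _ T). unfold zeta. apply Series_ext. intros n.
      assert (Hn := pos_INR n). rewrite S_INR, Rpower_plus, Rpower_1 by lra.
      unfold Rpower, pw. rewrite Rinv_mult, <- exp_Ropp.
      replace (- (u * ln (INR n + 1))) with (ln (INR n + 1) * - u) by ring.
      unfold Rdiv. ring. }
    split; [now rewrite Z|].
    replace (zeta (1 + u) - 1 / u) with (-1 * Series h) by (rewrite Z; ring).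
    apply is_series_ext_R with (2 := is_series_scal_R (-1) _ _ E1).
    intros k. replace (- u) with (-1 * u) by ring. rewrite Rpow_mult_distr.
    unfold emG, Rdiv. ring.
Qed.

Lemma zeta_laurent_emG : zeta_laurent emG.
Proof.
  exists (/ 2). split; [lra|]. intros s Hs. apply is_pseries_R.
  replace (zeta s) with (zeta (1 + (s - 1))) by (f_equal; ring).
  apply zeta_expansion. lra.
Qed.

(** [emG] is the witness by which the chosen sequence satisfies [zeta_laurent]; uniqueness of
    one-sided expansions then identifies the two. *)
Lemma stieltjes_emG (k : nat) : stieltjes k = emG k.
Proof.
  assert (H : zeta_laurent stieltjes)
    by exact (epsilon_spec (inhabits (fun _ : nat => 0)) zeta_laurent
                (ex_intro _ emG zeta_laurent_emG)).
  assert (egf : forall c, zeta_laurent c ->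
            has_egf (fun k => (-1) ^ k * c k) (fun u => zeta (1 + u) - 1 / u)).
  { intros c [d [Hd Hc]]. apply has_egf_of_is_series with d; [exact Hd|].
    intros u Hu. specialize (Hc (1 + u) ltac:(lra)).
    replace (1 + u - 1) with u in Hc by ring. exact (proj1 (is_pseries_R _ _ _) Hc). }
  assert (E := has_egf_unique 1 _ _ _ _ Rlt_0_1 (fun u _ => eq_refl)
    (egf _ H) (egf _ zeta_laurent_emG) k). simpl in E.
  apply Rmult_eq_reg_l with (1 := E). apply pow_nonzero. lra.
Qed.

(** The n-th term of the series in [psi] is the increment of logF k (n + y) - logF k n, minus [emD]
    at n + y, plus [emD] at n. The increments telescope from n = 1, where logF k 1 = 0, and the last
    part cancels the Stieltjes constant. *)
Lemma psi_emR (k : nat) (y : R) : 0 < y -> psi k y = emR k y + logF k y.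
Proof.
  intros Hy.
  assert (Hd : 0 < Rmin 1 y <= 1) by (split; [apply Rmin_pos; lra | apply Rmin_l]).
  destruct (emR_bounds (Rmin 1 y) y k Hd (Rmin_r _ _)) as [E _].
  destruct (emR_bounds 1 1 k ltac:(lra) ltac:(lra)) as [E1 _].
  assert (L := is_lim_seq_logF_shift k y Hy). apply is_lim_seq_incr_1 in L.
  assert (T := is_series_telescope _ _ L).
  assert (S1 : is_series (fun m => emD k (INR (S m) + y)) (emR k y - emD k y)).
  { apply (is_series_incr_1 (fun m => emD k (INR m + y))).
    replace (plus _ _) with (emR k y); [now apply Series_correct|].
    unfold plus; simpl. rewrite Rplus_0_l. ring. }
  assert (S2 := is_series_minus_R _ _ _ _ (is_series_minus_R _ _ _ _ T S1)
                  (is_series_scal_R (-1) _ _ (Series_correct _ E1))).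
  unfold psi. rewrite stieltjes_emG.
  rewrite (is_series_unique _ (0 - (logF k (1 + y)) - (emR k y - emD k y) - emG k)).
  - unfold emD, logf. rewrite (Rplus_comm y 1). ring.
  - replace (0 - logF k (1 + y)) with (0 - (logF k (INR 1 + y) - logF k (INR 1))).
    2:{ simpl INR. unfold logF at 2. rewrite ln_1, pow_i by lia. field.
        apply not_0_INR. lia. }
    replace (emG k) with (-1 * Series (fun m => emD k (INR m + 1))) by (unfold emG; ring).
    apply is_series_ext_R with (2 := S2).
    intros n. unfold emD. rewrite !S_INR.
    replace (INR n + 1 + 1 + y) with (INR n + 1 + y + 1) by ring. unfold logf. ring.
Qed.

(** * Derivatives of the Ishibashi functions *)

Definition wt (n : nat) : R := 1 / ((INR n + 1) * sqrt (INR n + 1)).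

Lemma emR_multiples_bounds (delta y : R) (k n : nat) : 0 < delta <= 1 -> delta <= y ->
  Rabs (emR k ((INR n + 1) * y) / (INR n + 1))
  <= bnd k delta * (2 * (1 + / delta) / (delta * sqrt delta) * wt n) /\
  Rabs (emR' k ((INR n + 1) * y))
  <= bnd k delta * (2 * (1 + / delta) / (delta * sqrt delta) * wt n).
Proof.
  intros Hd Hy. assert (Hn := pos_INR n). set (N := INR n + 1).
  assert (HN : 1 <= N) by (unfold N; lra).
  assert (HB := bnd_pos k delta ltac:(lra)).
  assert (Hi : 0 < / delta) by (apply Rinv_0_lt_compat; lra).
  assert (HNy : delta <= N * y) by nra.
  assert (Hsd : 0 < sqrt delta) by (apply sqrt_lt_R0; lra).
  assert (HsN : 0 < sqrt N) by (apply sqrt_lt_R0; lra).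
  assert (Hsdy : sqrt delta <= sqrt y) by (apply sqrt_le_1; lra).
  destruct (emR_bounds delta (N * y) k Hd HNy) as [_ [H1 [_ H2]]].
  rewrite sqrt_mult in H1, H2 by lra.
  assert (Hw : wt n = / (N * sqrt N)) by (unfold wt; fold N; unfold Rdiv; ring).
  rewrite Hw. split.
  - unfold Rdiv at 1. rewrite Rabs_mult, (Rabs_right (/ N)).
    2:{ apply Rle_ge, Rlt_le, Rinv_0_lt_compat. lra. }
    apply Rle_trans with
      (bnd k delta * (2 * (1 + / delta)) * / (sqrt N * sqrt y) * / N).
    + apply Rmult_le_compat_r; [apply Rlt_le, Rinv_0_lt_compat; lra | exact H1].
    + replace (bnd k delta * (2 * (1 + / delta)) * / (sqrt N * sqrt y) * / N)
        with (bnd k delta * (2 * (1 + / delta) * / sqrt y * / (N * sqrt N)))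
        by (field; lra).
      apply Rmult_le_compat_l; [lra|].
      apply Rmult_le_compat_r; [apply Rlt_le, Rinv_0_lt_compat; nra|].
      apply Rmult_le_compat_l; [lra|]. apply Rinv_le_contravar; nra.
  - apply Rle_trans with (1 := H2).
    replace (bnd k delta * (1 + / delta) * / (N * y * (sqrt N * sqrt y)))
      with (bnd k delta * ((1 + / delta) * / (y * sqrt y) * / (N * sqrt N)))
      by (field; lra).
    apply Rmult_le_compat_l; [lra|].
    apply Rmult_le_compat_r; [apply Rlt_le, Rinv_0_lt_compat; nra|].
    unfold Rdiv. apply Rmult_le_compat; [lra| |lra|].
    + apply Rlt_le, Rinv_0_lt_compat. nra.
    + apply Rinv_le_contravar; nra.
Qed.

Lemma ex_series_wt : ex_series wt.
Proof. exact (proj1 (ex_series_weights 1 ltac:(lra))). Qed.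

(** [Phi] subtracts exactly (k+1) * logF k (n y), so only emR k (n y) / n remains in each term; on
    differentiation the inner factor n cancels 1/n. *)
Lemma dPhi_Series_emR' (k : nat) (x : R) : 0 < x ->
  dPhi (k + 1) x = INR (k + 1) * Series (fun n => emR' k ((INR n + 1) * x)).
Proof.
  intros Hx. unfold dPhi. apply is_derive_unique.
  assert (Hr : 0 < x / 2) by lra.
  set (delta := Rmin 1 (x / 2)).
  assert (Hd : 0 < delta <= 1) by (split; [apply Rmin_pos; lra | apply Rmin_l]).
  assert (Hd2 : delta <= x / 2) by apply Rmin_r.
  apply is_derive_ext_loc with
    (fun y => INR (k + 1) * Series (fun n => emR k ((INR n + 1) * y) / (INR n + 1))).
  - exists (mkposreal _ Hr). intros y Hy. apply Rabs_def2 in Hy. simpl in Hy.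
    unfold minus, plus, opp in Hy; simpl in Hy.
    unfold Phi. rewrite <- Series_scal_l. apply Series_ext. intros n.
    assert (Hn := pos_INR n).
    rewrite Nat.add_sub, S_INR, psi_emR by (apply Rmult_lt_0_compat; lra). unfold logF. field.
    split; [apply not_0_INR; lia | lra].
  - apply is_derive_scal.
    apply (is_derive_Series (fun n y => emR k ((INR n + 1) * y) / (INR n + 1))
      (fun n y => emR' k ((INR n + 1) * y))
      (fun n => bnd k delta * (2 * (1 + / delta) / (delta * sqrt delta) * wt n))
      x (mkposreal _ Hr)).
    + intros n y Hy. simpl in Hy. apply Rabs_def2 in Hy. assert (Hn := pos_INR n).
      replace (emR' k ((INR n + 1) * y))
        with (/ (INR n + 1) * ((INR n + 1) * emR' k ((INR n + 1) * y))) by (field; lra).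
      apply is_derive_ext with (fun y => / (INR n + 1) * emR k ((INR n + 1) * y)).
      { intros z. unfold Rdiv. apply Rmult_comm. }
      apply is_derive_scal.
      apply (is_derive_comp (emR k) (fun z => (INR n + 1) * z) y
               (emR' k ((INR n + 1) * y)) (INR n + 1)).
      * apply is_derive_emR. nra.
      * auto_derive; [easy | ring].
    + intros n y Hy. simpl in Hy. apply Rabs_def2 in Hy.
      apply emR_multiples_bounds; lra.
    + intros y Hy. simpl in Hy. apply Rabs_def2 in Hy.
      apply ex_series_dominated with
        (fun n => bnd k delta * (2 * (1 + / delta) / (delta * sqrt delta) * wt n)).
      * intros n. apply (fun H H' => proj1 (emR_multiples_bounds delta y k n H H')); lra.
      * do 2 apply ex_series_scal_R. apply ex_series_wt.
    + do 2 apply ex_series_scal_R. apply ex_series_wt.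
Qed.

Definition qw (u z : R) : R := pw u z / z ^ 2.
(* The Hurwitz zeta value zeta(2+u, y). *)
Definition hurw (u y : R) : R := Series (fun m => qw u (INR m + y)).
(* The lattice sum of (n x + m)^(-2-u) over n >= 1, m >= 0. *)
Definition cone (u x : R) : R := Series (fun n => hurw u ((INR n + 1) * x)).

(** The differences of z^(-1-u) along y, y+1, ... telescope to -y^(-1-u); the derivative terms add
    up to (1 + u) zeta(2+u, y). *)
Lemma emR'_egf (u y : R) : 0 < u < / 2 -> 0 < y ->
  ex_series (fun m => qw u (INR m + y)) /\
  is_series (fun k => emR' k y / INR (fact k) * (- u) ^ k)
    ((1 + u) * hurw u y - pw u y / y).
Proof.
  intros Hu Hy.
  set (delta := Rmin 1 y).
  assert (Hd : 0 < delta <= 1) by (split; [apply Rmin_pos; lra | apply Rmin_l]).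
  assert (Hd2 : delta <= y) by apply Rmin_r.
  assert (Hm : forall m, 0 < INR m + y) by (intros m; generalize (pos_INR m); lra).
  set (h := fun m => pw u (INR m + y + 1) / (INR m + y + 1)
    - pw u (INR m + y) / (INR m + y) + (1 + u) * qw u (INR m + y)).
  destruct (is_series_egf_Series (fun k m => emD' k (INR m + y)) h
    (fun m => 4 / delta * (1 / ((INR m + delta) ^ 2 * sqrt (INR m + delta)))) (- u))
    as [E1 E2].
  - rewrite Rabs_left; lra.
  - intros k m. assert (Hn := pos_INR m).
    apply Rle_trans with (1 := proj2 (emD_bounds delta (INR m + y) k Hd ltac:(lra))).
    apply Rle_trans with (bnd k delta / ((INR m + delta) ^ 2 * sqrt (INR m + delta))).
    + apply div_pow_sqrt_antitone; [apply bnd_pos; lra|lra].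
    + right. unfold bnd. field.
      assert (0 < sqrt (INR m + delta)) by (apply sqrt_lt_R0; lra). lra.
  - apply ex_series_scal_R, ex_series_weights. lra.
  - intros m. apply is_series_emD'_egf. apply Hm.
  - assert (T := is_series_telescope _ _ (is_lim_seq_pw_div u y ltac:(lra))).
    assert (S : is_series (fun m => qw u (INR m + y))
              (/ (1 + u) * (Series h - (0 - pw u (INR 0 + y) / (INR 0 + y))))).
    { apply is_series_ext_R with (2 := is_series_scal_R (/ (1 + u)) _ _
        (is_series_minus_R _ _ _ _ (Series_correct _ E2) T)).
      intros m. unfold h.
      rewrite S_INR. replace (INR m + 1 + y) with (INR m + y + 1) by ring. field.
      generalize (Hm m). lra. }
    split; [eexists; exact S|].
    unfold hurw. rewrite (is_series_unique _ _ S). simpl INR. rewrite Rplus_0_l.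
    match goal with |- is_series _ ?l => replace l with (Series h) by (field; lra) end.
    exact E1.
Qed.

(** The exchange of sums controls only the combination [h]. Adding back the convergent sum of (n
    x)^(-1-u), which is x^(-1-u) zeta(1+u), shows that the lattice sum converges. *)
Lemma dPhi_egf (x u : R) : 0 < x -> 0 < u < / 2 ->
  ex_series (fun n => hurw u ((INR n + 1) * x)) /\
  is_series (fun k => (-1) ^ k * (dPhi (k + 1) x / INR (k + 1)) / INR (fact k) * u ^ k)
    ((1 + u) * cone u x - pw u x / x * zeta (1 + u)).
Proof.
  intros Hx Hu.
  set (delta := Rmin 1 x).
  assert (Hd : 0 < delta <= 1) by (split; [apply Rmin_pos; lra | apply Rmin_l]).
  assert (Hd2 : delta <= x) by apply Rmin_r.
  assert (Hn : forall n, 0 < (INR n + 1) * x) by (intros n; generalize (pos_INR n); nra).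
  assert (Hsd : 0 < sqrt delta) by (apply sqrt_lt_R0; lra).
  set (h := fun n => (1 + u) * hurw u ((INR n + 1) * x)
                     - pw u ((INR n + 1) * x) / ((INR n + 1) * x)).
  destruct (is_series_egf_Series (fun k n => emR' k ((INR n + 1) * x)) h
    (fun n => 4 / delta * (2 * (1 + / delta) / (delta * sqrt delta) * wt n)) (- u))
    as [E1 E2].
  - rewrite Rabs_left; lra.
  - intros k n.
    apply Rle_trans with (1 := proj2 (emR_multiples_bounds delta x k n Hd Hd2)).
    right. unfold bnd. field. lra.
  - do 2 apply ex_series_scal_R. apply ex_series_wt.
  - intros n. now apply emR'_egf.
  - destruct (zeta_expansion u Hu) as [Z _].
    apply (is_series_scal_R (pw u x / x)) in Z.
    assert (S := is_series_scal_R (/ (1 + u)) _ _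
      (is_series_plus _ _ _ _ (Series_correct _ E2) Z)).
    assert (S' : is_series (fun n => hurw u ((INR n + 1) * x))
              (/ (1 + u) * (Series h + pw u x / x * zeta (1 + u)))).
    { apply is_series_ext_R with (2 := S). intros n. unfold h, plus; simpl.
      assert (H := pos_INR n).
      rewrite pw_mult by lra. field. lra. }
    split; [eexists; exact S'|].
    unfold cone. rewrite (is_series_unique _ _ S').
    match goal with |- is_series _ ?l => replace l with (Series h) by (field; lra) end.
    apply is_series_ext_R with (2 := E1).
    intros k. rewrite dPhi_Series_emR' by exact Hx.
    replace (- u) with (-1 * u) by ring. rewrite Rpow_mult_distr. field.
    split; [apply not_0_INR; lia | apply INR_fact_neq_0].
Qed.

(** * The three-term relation *)

Lemma pw_div_pow_antitone (u y z : R) (i : nat) : 0 < u -> 0 < y <= z ->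
  pw u z / z ^ i <= pw u y / y ^ i.
Proof.
  intros Hu Hyz. assert (Hp := pow_lt y i ltac:(lra)).
  assert (Hp' := pow_lt z i ltac:(lra)).
  apply Rmult_le_compat.
  - apply Rlt_le, pw_pos.
  - now apply Rlt_le, Rinv_0_lt_compat.
  - assert (ln y <= ln z) by (apply ln_le; lra).
    assert (Hle : ln z * - u <= ln y * - u) by nra.
    unfold pw. destruct Hle as [Hlt|Heq]; [now apply Rlt_le, exp_increasing|].
    rewrite Heq. lra.
  - apply Rinv_le_contravar; [exact Hp|]. apply pow_incr. lra.
Qed.

Lemma qw_mult (u y z : R) : 0 < y -> 0 < z -> qw u (y * z) = qw u y * qw u z.
Proof. intros Hy Hz. unfold qw. rewrite pw_mult by auto. field. lra. Qed.

Lemma sum_f_R0_rev (f : nat -> R) (n : nat) :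
  sum_f_R0 f n = sum_f_R0 (fun i => f (n - i)%nat) n.
Proof.
  induction n as [|n IH]; [reflexivity|].
  rewrite (decomp_sum (fun i => f (S n - i)%nat)) by lia. simpl Init.Nat.pred.
  rewrite tech5, IH, Nat.sub_0_r. simpl. ring.
Qed.

Lemma cone_three_term (u x : R) : 1 < x -> 0 < u < / 2 ->
  cone u (x - 1) - cone u x = qw u x * cone u ((x - 1) / x).
Proof.
  intros Hx Hu.
  (* Half of the exponent 2 + u: for 1 <= j <= n the point n x - j is at least n (x - 1), and
     n^(-2-u) is the square of n^(-1-u/2), so one of the two factors can be weakened to j^(-1-u/2).
     This yields a product majorant, summable by the zeta series at 1 + u/2. *)
  set (w := fun n => pw (u / 2) (INR n + 1) / (INR n + 1)).
  (* For fixed n the points n x - j, 1 <= j <= n, are those of the cone of x-1 missing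
     from the cone of x; for fixed j they are x times (j (x-1)/x + m), m >= 0. *)
  set (a := fun n j => if (j <=? n)%nat
                       then qw u ((INR n + 1) * x - (INR j + 1)) else 0).
  assert (Ew : ex_series w) by (eexists; apply zeta_expansion; lra).
  assert (Hw : forall n, 0 < w n).
  { intros n. apply Rdiv_lt_0_compat; [apply pw_pos|]. generalize (pos_INR n). lra. }
  assert (Hq : forall z, 0 < z -> 0 < qw u z).
  { intros z Hz. apply Rdiv_lt_0_compat; [apply pw_pos | now apply pow_lt]. }
  assert (Ha : forall n j, Rabs (a n j) <= qw u (x - 1) * w n * w j).
  { intros n j. unfold a. assert (Hn := pos_INR n). assert (Hj := pos_INR j).
    assert (H0 := Hq (x - 1) ltac:(lra)).
    destruct (Nat.leb_spec j n) as [Hjn|Hjn].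
    - apply le_INR in Hjn.
      rewrite Rabs_right by (apply Rle_ge, Rlt_le, Hq; nra).
      apply Rle_trans with (qw u ((INR n + 1) * (x - 1))).
      { apply pw_div_pow_antitone; nra. }
      rewrite Rmult_comm, qw_mult, Rmult_assoc by lra.
      apply Rmult_le_compat_l; [lra|].
      replace (qw u (INR n + 1)) with (w n * w n).
      + apply Rmult_le_compat_l; [now apply Rlt_le|].
        unfold w. generalize (pw_div_pow_antitone (u / 2) (INR j + 1) (INR n + 1) 1).
        rewrite !pow_1. intros H. apply H; lra.
      + unfold w, qw, pw.
        replace (exp (ln (INR n + 1) * - u)) with
          (exp (ln (INR n + 1) * - (u / 2)) * exp (ln (INR n + 1) * - (u / 2))).
        * field. lra.
        * rewrite <- exp_plus. f_equal. field.
    - rewrite Rabs_R0. generalize (Hw n) (Hw j). intros.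
      apply Rmult_le_pos; [apply Rmult_le_pos|]; lra. }
  assert (Ew' := ex_series_scal_R (qw u (x - 1)) _ Ew).
  assert (E := is_series_swap _ _ _ Ha Ew' Ew).
  assert (Eh : forall y, 0 < y -> ex_series (fun m => qw u (INR m + y)))
    by (intros y Hy; now apply emR'_egf).
  assert (Ec : forall y, 0 < y -> ex_series (fun n => hurw u ((INR n + 1) * y)))
    by (intros y Hy; now apply dPhi_egf).
  unfold cone at 1 2. rewrite <- Series_minus by (apply Ec; lra).
  rewrite (Series_ext _ (fun n => Series (fun j => a n j))).
  - rewrite (is_series_unique _ _ E). unfold cone. rewrite <- Series_scal_l.
    apply Series_ext. intros j. assert (Hj := pos_INR j).
    rewrite (Series_incr_n_aux (fun n => a n j) j).
    2:{ intros n Hn. unfold a. now destruct (Nat.leb_spec j n); [lia|]. }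
    unfold hurw. rewrite <- Series_scal_l. apply Series_ext. intros m.
    assert (Hm := pos_INR m).
    unfold a. destruct (Nat.leb_spec j (j + m)) as [_|H]; [|lia].
    assert (0 < (INR j + 1) * ((x - 1) / x))
      by (apply Rmult_lt_0_compat; [|apply Rdiv_lt_0_compat]; lra).
    rewrite <- qw_mult by lra. f_equal. rewrite plus_INR. field. lra.
  - intros n. assert (Hn := pos_INR n).
    (* Row S n of the cone of x - 1 is cut at m = S n: the later terms are the same row for x, and a
       term m <= n is a n (n - m), hence the reversal below. *)
    unfold hurw at 1. rewrite (Series_incr_n _ (S n)); [|lia|apply Eh; nra].
    rewrite (Series_incr_n (fun j => a n j) (S n)).
    2:lia.
    2:{ apply ex_series_dominated with (1 := Ha n). now apply ex_series_scal_R. }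
    simpl Init.Nat.pred.
    rewrite (Series_ext (fun k => a n (S n + k)%nat) (fun _ => 0 * 0)).
    2:{ intros m. unfold a. destruct (Nat.leb_spec (S n + m) n); [lia|ring]. }
    rewrite Series_scal_l, Rmult_0_l, Rplus_0_r.
    rewrite (Series_ext (fun k => qw u (INR (S n + k) + (INR n + 1) * (x - 1)))
      (fun k => qw u (INR k + (INR n + 1) * x))).
    2:{ intros m. f_equal. rewrite plus_INR, S_INR. ring. }
    unfold hurw, Rminus. rewrite Rplus_assoc, Rplus_opp_r, Rplus_0_r.
    rewrite (sum_f_R0_rev (fun j => a n j)). apply sum_eq. intros m Hm.
    unfold a. destruct (Nat.leb_spec (n - m) n); [|lia].
    f_equal. rewrite minus_INR by lia. ring.
Qed.

(** * Comparison of coefficients *)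

Definition lnconv (c : R) (j : nat) : R :=
  sum_f_R0 (fun l => Binomial.C j l * (- c) ^ l * ((-1) ^ (j - l) * stieltjes (j - l))) j.

Lemma lnconv_egf (c : R) :
  has_egf (lnconv c) (fun u => exp (- c * u) * (zeta (1 + u) - 1 / u)).
Proof.
  apply (has_egf_mult (fun l => (- c) ^ l) (fun l => (-1) ^ l * stieltjes l)).
  - apply has_egf_exp.
  - apply has_egf_of_is_series with (/ 2); [lra|]. intros u Hu.
    destruct (zeta_expansion u Hu) as [_ Z]. apply is_series_ext_R with (2 := Z).
    intros k. now rewrite stieltjes_emG.
Qed.

(** Splitting (-1)^j = (-1)^l (-1)^(j-l) gives one sign to the logarithm and one to the Stieltjes
    constant, as in the expansion of exp(-c u) (zeta(1+u) - 1/u). *)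
Lemma sum_lnconv (j : nat) (c1 c2 c3 a1 a2 a3 : R) :
  sum_f_R0 (fun l => Binomial.C j l * (-1) ^ j * stieltjes (j - l)
                     * (a1 * c1 ^ l - a2 * c2 ^ l + a3 * c3 ^ l)) j
  = a1 * lnconv c1 j - a2 * lnconv c2 j + a3 * lnconv c3 j.
Proof.
  unfold lnconv. rewrite !scal_sum, <- minus_sum, <- plus_sum.
  apply sum_eq. intros l Hl.
  assert (Hs : (-1) ^ j = (-1) ^ l * (-1) ^ (j - l))
    by (rewrite <- pow_add; f_equal; lia).
  assert (Hc : forall c, (- c) ^ l = (-1) ^ l * c ^ l)
    by (intros c; rewrite <- Rpow_mult_distr; f_equal; ring).
  rewrite Hs, !Hc. ring.
Qed.

Theorem theorem3p8 (k : nat) (x : R) (hx : 1 < x) :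
  sum_f_R0 (fun j =>
    Binomial.C k j * ((-1) ^ (j + 1) / INR (j + 1)) * (ln x / 2) ^ (k - j)
    * (dPhi (j + 1) x - dPhi (j + 1) (x - 1)
       + 1 / x ^ 2 * (-1) ^ (k - j) * dPhi (j + 1) ((x - 1) / x))) k
  =
  sum_f_R0 (fun j =>
    Binomial.C k j * (ln x / 2) ^ (k - j)
    * sum_f_R0 (fun l =>
        Binomial.C j l * (-1) ^ j * stieltjes (j - l)
        * (ln x ^ l / x - ln (x - 1) ^ l / (x - 1)
           + (-1) ^ (k - j) * ln ((x - 1) / x) ^ l / (x * (x - 1)))) j) k
  + 1 / (INR (k + 1) * x)
    * ((- ln x / 2) ^ (k + 1) - (ln x / 2 - ln (x - 1)) ^ (k + 1)).
Proof.
  set (w := (x - 1) / x). set (c := ln x / 2).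
  assert (Hw : 0 < w) by (apply Rdiv_lt_0_compat; lra).
  assert (Hc : forall i, (- c) ^ i = (-1) ^ i * c ^ i)
    by (intros i; rewrite <- Rpow_mult_distr; f_equal; ring).
  set (e := fun y j => (-1) ^ j * (dPhi (j + 1) y / INR (j + 1))).
  assert (He : forall y, 0 < y ->
    has_egf (e y) (fun u => (1 + u) * cone u y - pw u y / y * zeta (1 + u))).
  { intros y Hy. apply has_egf_of_is_series with (/ 2); [lra|]. intros u Hu.
    now apply dPhi_egf. }
  (* Multiplication by x^(u/2) = exp(c u) turns the factor x^(-2-u) of the third term into x^(-2)
     exp(-c u); this is the source of the sign (-1)^(k-j) there. *)
  assert (HL := has_egf_plus _ _ _ _
    (has_egf_mult _ _ _ _
      (has_egf_plus _ _ _ _ (has_egf_scal (-1) _ _ (He x ltac:(lra)))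
         (He (x - 1) ltac:(lra)))
      (has_egf_exp c))
    (has_egf_mult _ _ _ _ (has_egf_scal (-1 / x ^ 2) _ _ (He w Hw)) (has_egf_exp (- c)))).
  (* The last two summands come from the poles 1/u of the three zeta factors: these add up to
     (exp(-c u) - exp((c - ln(x-1)) u)) / (u x), which is regular at u = 0. *)
  assert (HR := has_egf_plus _ _ _ _ (has_egf_plus _ _ _ _
    (has_egf_mult _ _ _ _
      (has_egf_plus _ _ _ _ (has_egf_scal (/ x) _ _ (lnconv_egf (ln x)))
         (has_egf_scal (- / (x - 1)) _ _ (lnconv_egf (ln (x - 1)))))
      (has_egf_exp c))
    (has_egf_mult _ _ _ _ (has_egf_scal (/ (x * (x - 1))) _ _ (lnconv_egf (ln w)))
      (has_egf_exp (- c))))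
    (has_egf_plus _ _ _ _
      (has_egf_scal (/ x) _ _ (has_egf_expm1_div (- c)))
      (has_egf_scal (- / x) _ _ (has_egf_expm1_div (c - ln (x - 1)))))).
  assert (E := fun H => has_egf_unique (/ 2) _ _ _ _ ltac:(lra) H HL HR k).
  cbv beta in E. clear HL HR.
  replace (1 / (INR (k + 1) * x) * ((- ln x / 2) ^ (k + 1) - (c - ln (x - 1)) ^ (k + 1)))
    with (/ x * ((- c) ^ (k + 1) / INR (k + 1))
          + - / x * ((c - ln (x - 1)) ^ (k + 1) / INR (k + 1))).
  2:{ replace (- ln x / 2) with (- c) by (unfold c; field). field.
      split; [lra | apply not_0_INR; lia]. }
  match type of E with _ -> ?l = ?r => transitivity l; [|transitivity r] end.
  - rewrite <- plus_sum. apply sum_eq. intros j Hj. rewrite Hc, pow_add. unfold e. field.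
    split; [apply not_0_INR; lia | lra].
  - apply E. clear E. intros u Hu.
    assert (T := cone_three_term u x hx Hu). fold w in T.
    replace (cone u (x - 1)) with (cone u x + qw u x * cone u w) by lra.
    (* With i = x^(-u/2) and q = ((x-1)/x)^(-u) the identity is rational in i, q. *)
    set (i := exp (- c * u)). set (q := pw u w).
    assert (Hi : 0 < i) by apply exp_pos.
    assert (Hq : 0 < q) by apply exp_pos.
    assert (Hpx : pw u x = i * i).
    { unfold pw, i. rewrite <- exp_plus. f_equal. unfold c. field. }
    assert (Hpx1 : pw u (x - 1) = q * (i * i)).
    { unfold q. rewrite <- Hpx, <- pw_mult by lra. f_equal. unfold w. field. lra. }
    assert (Hexp : forall y, exp (- ln y * u) = pw u y)
      by (intros y; unfold pw; f_equal; ring).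
    assert (Hci : exp (c * u) = / i)
      by (unfold i; rewrite <- exp_Ropp; f_equal; ring).
    assert (Hc2 : exp ((c - ln (x - 1)) * u) = q * i).
    { replace ((c - ln (x - 1)) * u) with (c * u + - ln (x - 1) * u) by ring.
      rewrite exp_plus, Hci, Hexp, Hpx1. field. lra. }
    unfold qw. rewrite !Hexp, Hci, Hc2, Hpx, Hpx1. fold q. unfold w.
    field. lra.
  - f_equal. rewrite <- plus_sum. apply sum_eq. intros j Hj.
    rewrite (sum_eq _ (fun l => Binomial.C j l * (-1) ^ j * stieltjes (j - l)
      * (/ x * ln x ^ l - / (x - 1) * ln (x - 1) ^ l
         + (-1) ^ (k - j) / (x * (x - 1)) * ln w ^ l))).
    2:{ intros l Hl. field. lra. }
    rewrite sum_lnconv, Hc. field. lra.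
Qed.
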